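(* Let $q$ be a prime power, $n\ge1$, $V$ an $(n+1)$-dimensional vector space over $\mathbb F_q$, and let $\mathcal C(\Lambda_1)$ be the linear code associated to the projective system $\Lambda_1\subseteq \mathrm{PG}(V\otimes V^* )$ of points $[x\otimes\xi]$ with $0\ne x\in V$, $0\neq \xi\in V^*$, $\xi(x)=0$. Then: (1) The set of weights of $\mathcal C(\Lambda_1)$ is in bijective correspondence with the set \[\{(g_1,\dots,g_t)\colon \textstyle\sum_{i=1}^t g_i\le n+1,\ 1\le g_1\le\dots\le g_t\le n+1,\ 1\le t\le q\}\cup\{0\}\] (the $g_i$ and $t$ being integers). (2) $\mathcal C(\Lambda_1)$ admits an automorphism group isomorphic to the central product $\mathrm{PGL}(n+1,q)\cdot\mathbb F_q^{\star}$.
   Context: For a projective system $\Omega=\{[v_1],\dots,[v_N]\}$ (a spanning set of $N$ distinct points of a finite projective space), $\mathcal C(\Omega)$ is the linear code whose generator matrix has as columns fixed representatives $v_1,\dots,v_N$ (defined up to monomial equivalence). An automorphism of a linear code is a linear map of the code onto itself preserving the Hamming weight of every codeword. $\mathbb F_q^{\star}$ is the multiplicative group of $\mathbb F_q$. *)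

(* Defs.v *)
From HB Require Import structures.
From mathcomp Require Export all_boot all_order all_algebra all_fingroup.
From mathcomp Require Export all_solvable.
From mathcomp.classical Require Export classical_sets functions.
Set Implicit Arguments.
Unset Strict Implicit.
Unset Printing Implicit Defensive.
Import GRing.Theory.
Local Open Scope ring_scope.

Section Tensor.
Variable F : fieldType.

Definition dual (V : vectType F) := 'Hom(V, F^o).

(* U (x) W is realised as the space of coefficient matrices with respect to
   the tensor products of basis vectors; [tens_universal] shows that this is a
   tensor product. *)
Definition tensor (U W : vectType F) := 'M[F]_(\dim {:U}, \dim {:W}).

Definition tens (U W : vectType F) (u : U) (w : W) : tensor U W :=
  \matrix_(i, j) (coord (vbasis {:U}) i u * coord (vbasis {:W}) j w).

Lemma tens_linear_l (U W : vectType F) (w : W) : linear (fun u : U => tens u w).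
Proof. by move=> a u v; apply/matrixP=> i j; rewrite !mxE linearP mulrDl mulrA. Qed.

Lemma tens_linear_r (U W : vectType F) (u : U) : linear (fun w : W => tens u w).
Proof.
by move=> a v w; apply/matrixP=> i j; rewrite !mxE linearP mulrDr mulrCA.
Qed.

Lemma tens_vbasis (U W : vectType F) (i : 'I_(\dim {:U})) (j : 'I_(\dim {:W})) :
  tens (vbasis {:U})`_i (vbasis {:W})`_j = delta_mx i j :> tensor U W.
Proof.
apply/matrixP=> k l; rewrite !mxE.
rewrite !coord_free ?(basis_free (vbasisP _)) //.
by rewrite -natrM mulnb [k == i]eq_sym [l == j]eq_sym.
Qed.

Lemma tens_universal (U W Z : vectType F) (b : U -> W -> Z) :
  (forall w, linear (fun u => b u w)) -> (forall u, linear (b u)) ->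
  exists! f : 'Hom(tensor U W, Z), forall u w, f (tens u w) = b u w.
Proof.
move=> bl br.
pose f (M : tensor U W) : Z :=
  \sum_i \sum_j M i j *: b (vbasis {:U})`_i (vbasis {:W})`_j.
have f_lin : linear f.
  move=> a M N; rewrite /f scaler_sumr -big_split /=; apply: eq_bigr => i _.
  rewrite scaler_sumr -big_split /=; apply: eq_bigr => j _.
  by rewrite !mxE scalerDl scalerA.
pose fL := HB.pack f (GRing.isLinear.Build F _ _ _ f f_lin)
  : {linear tensor U W -> Z}.
exists (linfun fL); split=> [u w|g gP].
  rewrite lfunE /= /f.
  pose lU w' := HB.pack (fun u' => b u' w')
    (GRing.isLinear.Build F _ _ _ _ (bl w')) : {linear U -> Z}.
  pose lW u' := HB.pack (b u')
    (GRing.isLinear.Build F _ _ _ _ (br u')) : {linear W -> Z}.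
  rewrite {2}(coord_vbasis (memvf u)) -[RHS]/(lU w _) linear_sum.
  apply: eq_bigr => i _; rewrite linearZ /=.
  rewrite {2}(coord_vbasis (memvf w)) -[X in _ *: X]/(lW _ _) linear_sum.
  rewrite scaler_sumr; apply: eq_bigr => j _.
  by rewrite linearZ /= scalerA mxE.
apply/lfunP=> M; rewrite lfunE /= /f [in RHS](matrix_sum_delta M) linear_sum.
apply: eq_bigr => i _; rewrite linear_sum; apply: eq_bigr => j _.
by rewrite linearZ /= -tens_vbasis gP.
Qed.

End Tensor.

Section Codes.
Variable F : finFieldType.

(* The points of PG(W) are the lines <[v]> of W, [v] nonzero.  The vectors
   [v 0, ..., v (N - 1)] represent a set [Omega] of points when each point of
   [Omega] is spanned by exactly one of them. *)
Definition representatives (W : vectType F) (Omega : {vspace W} -> Prop) (N : nat)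
    (v : 'I_N -> W) : Prop :=
  [/\ forall j, v j != 0,
      injective (fun j => <[v j]>%VS)
    & forall P, Omega P <-> exists j, P = <[v j]>%VS].

(* The columns are the coordinate vectors of the [v j] in the ambient space; if
   the [v j] only span a proper subspace, then some rows are redundant, but the
   row space is the one obtained from coordinates in that subspace. *)
Definition generator_matrix (W : vectType F) (N : nat) (v : 'I_N -> W) :
    'M[F]_(\dim {:W}, N) :=
  \matrix_(i, j) coord (vbasis {:W}) i (v j).

Definition code (W : vectType F) (N : nat) (v : 'I_N -> W) : {vspace 'rV[F]_N} :=
  <<[seq row i (generator_matrix v) | i : 'I_(\dim {:W})]>>%VS.

Definition hamming_weight (N : nat) (c : 'rV[F]_N) : nat :=
  #|[set j | c ord0 j != 0]|.

Definition code_weights (N : nat) (C : {vspace 'rV[F]_N}) : set nat :=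
  [set w | exists2 c, c \in C & hamming_weight c = w]%classic.

(* As for [Aut] of a finite group, a bijection of [C] onto itself is encoded as
   the permutation of the ambient space that extends it by the identity. *)
Definition code_aut (N : nat) (C : {vspace 'rV[F]_N}) : {set {perm 'rV[F]_N}} :=
  [set s | [&& perm_on [set c | c \in C] s,
    [forall a : F, forall u in C, forall v in C,
       s (a *: u + v) == a *: s u + s v] &
    [forall u in C, hamming_weight (s u) == hamming_weight u]]].

Lemma code_aut_group_set N (C : {vspace 'rV[F]_N}) : group_set (code_aut C).
Proof.
apply/group_setP; split=> [|s t].
  rewrite inE perm_on1; apply/andP; split=> //.
  apply/andP; split.
    by apply/forallP=> a; apply/forall_inP=> u _; apply/forall_inP=> v _;
       rewrite !perm1.
  by apply/forall_inP=> u _; rewrite perm1.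
rewrite !inE => /and3P[sC sL sW] /and3P[tC tL tW].
have sM u : u \in C -> s u \in C by have := perm_closed u sC; rewrite !inE => ->.
apply/and3P; split; first exact: perm_onM.
  apply/forallP=> a; apply/forall_inP=> u uC; apply/forall_inP=> v vC.
  rewrite !permM.
  have /eqP-> := forall_inP (forall_inP (forallP sL a) u uC) v vC.
  exact: forall_inP (forall_inP (forallP tL a) _ (sM u uC)) _ (sM v vC).
apply/forall_inP=> u uC; rewrite permM.
have /eqP-> := forall_inP tW _ (sM u uC).
exact: (forall_inP sW u uC).
Qed.
Canonical code_aut_group N (C : {vspace 'rV[F]_N}) := Group (code_aut_group_set C).

Definition Lambda1 (V : vectType F) (P : {vspace tensor V (dual V)}) : Prop :=
  exists (x : V) (xi : dual V),
    [/\ x != 0, xi != 0, xi x = 0 & P = <[tens x xi]>%VS].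

End Codes.

(* PGL(m, F); ['GL_m[F]] is meaningful for 0 < m only. *)
Definition PGL (m : nat) (F : finFieldType) := ('GL_m[F] / 'Z('GL_m[F]))%g.

Definition profiles (q n : nat) : set (seq nat) :=
  [set g | [/\ (\sum_(i <- g) i <= n.+1)%N,
               all (fun i => 1 <= i <= n.+1)%N g,
               sorted leq g
             & (1 <= size g <= q)%N]]%classic.

(* Main.v *)
(* In coordinates, codewords come from square matrices [A] over the field with
   [q] elements, the entry at the point [x (x) y] being [x A y^T].  A vector [x]
   that is not an eigenvector of [A] lies in the same number of flags [(x, y)]
   with [x A y^T != 0], and an eigenvector lies in none, so the weight of [A]
   amounts to the number [sum_i (q ^ g_i - 1)] of its eigenvectors, where the
   [g_i] are the dimensions of its eigenspaces.  As there are at most [q] of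
   them, the [g_i] can be read off this sum by reducing it modulo [q] repeatedly.
   Conjugations and scalar multiplications of matrices preserve weights.  A
   conjugation by [g] that is trivial modulo scalar matrices fixes the nilpotent
   elementary matrices, hence [g] is scalar and the conjugations form PGL. *)

From HB Require Import structures.
Require Import Defs.
From mathcomp Require Import mxabelem zify ring boolp.
Set Implicit Arguments.
Unset Strict Implicit.
Unset Printing Implicit Defensive.
Import GRing.Theory.
Local Open Scope ring_scope.

(** * Multisets of dimensions *)

Section Profiles.
Local Open Scope nat_scope.
Variable q : nat.
Hypothesis q_gt1 : 1 < q.

(* The number of eigenvectors over a field with [q] elements of a matrix whose
   eigenspaces have the dimensions [g]. *)
Definition excess (g : seq nat) := \sum_(i <- g) (q ^ i - 1).

Lemma excess_cons i g : excess (i :: g) = q ^ i - 1 + excess g.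
Proof. exact: big_cons. Qed.

(** For [i > 0] one has [q^i - 1 = q (q^(i-1) - 1) + (q - 1)], and zero entries contribute nothing
    on either side. *)
Lemma excess_pred g :
  excess g = q * excess (map predn g) + (q - 1) * count (ltn 0) g.
Proof.
elim: g => [|i g IH]; first by rewrite /excess !big_nil !muln0.
rewrite /= !excess_cons IH; case: i => [|i] /=; first by rewrite !expn0; nia.
have : 0 < q ^ i by rewrite expn_gt0; lia.
by rewrite expnS; nia.
Qed.

Lemma excess_eq0 g : (excess g == 0) = (count (ltn 0) g == 0).
Proof.
elim: g => [|i g IH]; first by rewrite /excess big_nil.
rewrite excess_cons /= !addn_eq0 IH; congr (_ && _); rewrite eqb0 subn_eq0.
by rewrite -{1}(expn0 q) leq_exp2l // leqNgt.
Qed.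

(* [excess g] modulo [q] determines the number of positive entries of [g] up to
   the ambiguity between [0] and [q], which [excess_eq0] resolves. *)
Lemma excess_count_gt0 g h : size g <= q -> size h <= q ->
  excess g = excess h -> count (ltn 0) g = count (ltn 0) h.
Proof.
move=> sg sh e; have := excess_eq0 g; rewrite e excess_eq0.
have := e; rewrite (excess_pred g) (excess_pred h).
have := leq_trans (count_size (ltn 0) g) sg.
have := leq_trans (count_size (ltn 0) h) sh.
move: (count _ g) (count _ h) (excess _) (excess _) => c d s t le_dq le_cq e1 e2.
(* Adding the count to [excess] gives a multiple of [q], so both counts are congruent modulo [q] to
   minus the common [excess]. *)
have E x y : (x + y) * q = q * x + (q - 1) * y + y.
  by rewrite mulnDl mulnC -addnA -mulSnr subn1 prednK ?(ltnW q_gt1) // [y * q]mulnC.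
have : c = d %[mod q].
  rewrite -(modnMDl (s + d)) -[RHS](modnMDl (t + c)) !E -e1.
  by rewrite -!addnA [c + d]addnC.
have [ltcq|] := ltnP c q; have [ltdq|] := ltnP d q.
- by rewrite !modn_small.
- move=> ?; have -> : d = q by lia.
  by rewrite modnn modn_small // => c0; move: e2; rewrite c0; lia.
- move=> ?; have -> : c = q by lia.
  by rewrite modnn modn_small // => d0; move: e2; rewrite -d0; lia.
by lia.
Qed.

(** Lowering all entries by one shifts the threshold [k]. Once the counts of positive entries agree,
    [excess_pred] passes the equality of [excess] on to the lowered lists. *)
Lemma excess_count g h : size g <= q -> size h <= q -> excess g = excess h ->
  forall k, count (ltn k) g = count (ltn k) h.
Proof.
move=> sg sh e k; elim: k g h sg sh e => [|k IH] g h sg sh e.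
  exact: excess_count_gt0.
have E l : count (ltn k.+1) l = count (ltn k) (map predn l).
  by rewrite count_map; apply: eq_count => -[].
rewrite !E; apply: IH; rewrite ?size_map //.
have := e; rewrite (excess_pred g) (excess_pred h) (excess_count_gt0 sg sh e) => /addIn/eqP.
by rewrite eqn_pmul2l ?(ltnW q_gt1) // => /eqP.
Qed.

Lemma count_ltn_pred k g : 0 < k ->
  count (ltn k.-1) g = count_mem k g + count (ltn k) g.
Proof. by move=> ?; elim: g => //= i g ->; lia. Qed.

(** The multiplicity of [k > 0] is the difference of the counts above [k - 1] and above [k], and
    multiplicities determine a sorted list. *)
Lemma excess_inj g h : sorted leq g -> sorted leq h ->
  all (ltn 0) g -> all (ltn 0) h -> size g <= q -> size h <= q ->
  excess g = excess h -> g = h.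
Proof.
move=> og oh pg ph sg sh e.
apply: (sorted_eq leq_trans anti_leq og oh).
apply/allP => k; rewrite mem_cat => kin.
have k_gt0 : 0 < k by case/orP: kin => [/(allP pg)|/(allP ph)].
have := excess_count sg sh e k.-1.
by rewrite !count_ltn_pred // (excess_count sg sh e k) => /addIn e2; apply/eqP.
Qed.

End Profiles.

(** * Eigenvectors and eigenspace dimensions *)

Section Eigenvectors.
Variables (F : finFieldType) (m : nat).
Implicit Types (A : 'M[F]_m) (x : 'rV[F]_m) (a : F).

Definition eigenvectors A a := [set x : 'rV[F]_m | (x != 0) && (x *m A == a *: x)].

Definition num_eigenvectors A := (\sum_a #|eigenvectors A a|)%N.

Definition eigenprofile A : seq nat :=
  sort leq [seq d <- [seq \rank (eigenspace A a) | a <- enum F] | (0 < d)%N].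

Lemma card_submx k (B : 'M[F]_(k, m)) :
  #|[set x : 'rV[F]_m | (x <= B)%MS]| = (#|F| ^ \rank B)%N.
Proof. by rewrite -card_rowg; apply: eq_card => x; rewrite !inE. Qed.

Lemma card_eigenvectors A a :
  #|eigenvectors A a| = (#|F| ^ \rank (eigenspace A a) - 1)%N.
Proof.
rewrite -card_submx [in RHS](cardsD1 0) inE sub0mx add1n subn1 /=.
by apply: eq_card => x; rewrite !inE (sameP eigenspaceP eqP).
Qed.

Lemma num_eigenvectorsE A :
  num_eigenvectors A = excess #|F| (eigenprofile A).
Proof.
rewrite /excess (perm_big _ (permEl (perm_sort _ _))) /= big_filter big_map.
rewrite big_enum_cond big_mkcondr /=; apply: eq_bigr => a _.
by rewrite card_eigenvectors; case: posnP => [->|//]; rewrite expn0 subnn.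
Qed.

(** The zero vector gives the successor; any other such vector has exactly one eigenvalue, so the
    sum counts it once. *)
Lemma card_eigenlines A :
  #|[set x : 'rV[F]_m | (x *m A <= x)%MS]| = (num_eigenvectors A).+1.
Proof.
rewrite (cardsD1 0) inE mul0mx sub0mx add1n; congr _.+1.
rewrite /num_eigenvectors; under eq_bigr => a _ do rewrite -sum1_card.
rewrite (exchange_big_dep predT) //= -sum1_card big_mkcond /=.
apply: eq_bigr => x _; rewrite !inE; case: eqVneq => [->|x0] /=.
  by rewrite big1 // => a; rewrite inE eqxx.
case: sub_rVP => [[a xA]|nxA]; last first.
  by rewrite big1 // => a; rewrite inE => /andP[_ /eqP xA]; case: nxA; exists a.
rewrite (big_pred1 a) // => b; rewrite !inE x0 xA /= eq_sym -subr_eq0 -scalerBl.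
by rewrite scaler_eq0 (negPf x0) orbF subr_eq0.
Qed.

Lemma eigenprofile_sorted A : sorted leq (eigenprofile A).
Proof. exact/sort_sorted/leq_total. Qed.

Lemma eigenprofile_gt0 A : all (ltn 0) (eigenprofile A).
Proof. by rewrite all_sort filter_all. Qed.

Lemma size_eigenprofile A : (size (eigenprofile A) <= #|F|)%N.
Proof.
rewrite size_sort size_filter (leq_trans (count_size _ _)) //.
by rewrite size_map -cardE.
Qed.

Lemma sumn_eigenprofile A : (\sum_(i <- eigenprofile A) i <= m)%N.
Proof.
rewrite (perm_big _ (permEl (perm_sort _ _))) /= big_filter big_map.
rewrite big_mkcond /=.
rewrite (eq_bigr (fun a => \rank (eigenspace A a))); last by move=> a _; case: posnP.
(* Eigenspaces of distinct eigenvalues form a direct sum, so their ranks add up to at most [m]. *)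
have /mxdirectP /= e : mxdirect (\sum_a eigenspace A a).
  by apply: (@mxdirect_sum_eigenspace _ _ _ A predT id) => ? ? _ _.
by rewrite big_enum /= -e rank_leq_col.
Qed.

Lemma eigenprofile_eq A g : sorted leq g -> all (ltn 0) g -> (size g <= #|F|)%N ->
  num_eigenvectors A = excess #|F| g -> eigenprofile A = g.
Proof.
rewrite num_eigenvectorsE => og pg sg; apply: excess_inj => //.
- exact: finalg.card_finNzRing_gt1.
- exact: eigenprofile_sorted.
- exact: eigenprofile_gt0.
- exact: size_eigenprofile.
Qed.

Lemma linear_mx p (f : 'rV[F]_m -> 'rV[F]_p) : linear f ->
  exists A : 'M[F]_(m, p), forall x, x *m A = f x.
Proof.
move=> lf; pose fL := HB.pack f (GRing.isLinear.Build F _ _ _ f lf)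
  : {linear 'rV[F]_m -> 'rV[F]_p}.
by exists (lin1_mx fL) => x; rewrite mul_rV_lin1.
Qed.

End Eigenvectors.

(** * Matrices with a prescribed eigenvalue profile *)

Section Realization.
Variables (F : finFieldType) (m : nat).
Implicit Types (A : 'M[F]_m) (x : 'rV[F]_m) (a : F) (L : seq F).

(** The value 0 beyond [m] lets a shift refer to the coordinate [k.+1] uniformly, even for the last
    [k]. *)
Definition entry x (k : nat) : F := if insub k is Some i then x ord0 i else 0.

Lemma entry_ord x (i : 'I_m) : entry x i = x ord0 i.
Proof. by rewrite /entry valK. Qed.

Lemma entry_ge x k : (m <= k)%N -> entry x k = 0.
Proof. by move=> ?; rewrite /entry insubN // -leqNgt. Qed.

Lemma entry_linear k : linear (entry^~ k : 'rV_m -> F^o).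
Proof.
move=> a x y; rewrite /entry; case: insub => [i|]; first by rewrite !mxE.
by rewrite scaler0 addr0.
Qed.

Lemma entryD x y k : entry (x + y) k = entry x k + entry y k.
Proof. by have := entry_linear k 1 x y; rewrite !scale1r. Qed.

Lemma entryZ a x k : entry (a *: x) k = a * entry x k.
Proof.
by rewrite -{1}[x]subr0 /entry; case: insub => [i|]; rewrite ?subr0 ?mxE ?mulr0.
Qed.

Lemma row_entry x : x = \row_(i < m) entry x i.
Proof. by apply/rowP => i; rewrite mxE entry_ord. Qed.

Lemma card_supported (S : {set 'I_m}) :
  #|[set x : 'rV[F]_m | [forall i, (x ord0 i != 0) ==> (i \in S)]]| = (#|F| ^ #|S|)%N.
Proof.
rewrite -(@card_pffun_on _ _ (0 : F) S predT).
pose h (x : 'rV[F]_m) := [ffun i => x ord0 i].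
have h_inj : injective h.
  by move=> x y /ffunP e; apply/rowP => i; have := e i; rewrite !ffunE.
rewrite -(card_imset _ h_inj); apply: eq_card => f.
apply/imsetP/pffun_onP => [[x + ->]|[sf _]].
  rewrite inE => /forallP xS; split=> //.
  by apply/fintype.subsetP => i; rewrite inE ffunE; apply/implyP.
exists (\row_i f i); last by apply/ffunP => i; rewrite ffunE mxE.
rewrite inE; apply/forallP => i; rewrite mxE; apply/implyP => fi.
exact: (fintype.subsetP sf).
Qed.

Lemma card_positions L a : (size L <= m)%N ->
  #|[set i : 'I_m | (i < size L)%N && (nth 0 L i == a)]| = count_mem a L.
Proof.
move=> sL; rewrite -sum1_count (big_nth 0) big_mkord.
rewrite (big_ord_widen_cond m (fun i => pred1 a (nth 0 L i)) (fun _ => 1%N) sL).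
by rewrite -sum1_card; apply: eq_bigl => i; rewrite inE andbC.
Qed.

(* A triangular matrix with diagonal [L], continued by a Jordan-like chain
   attached to the last entry of [L]: the chain extends the generalized
   eigenspace of that entry without enlarging its eigenspace. *)
Lemma exists_mx_eigenvalues L : L != [::] -> (size L <= m)%N ->
  exists A, forall a, #|eigenvectors A a| = (#|F| ^ count_mem a L - 1)%N.
Proof.
move=> L0 sL; pose s := size L; have s_gt0 : (0 < s)%N by rewrite /s lt0n size_eq0.
(* The default [l] of [nth] prolongs the diagonal by the last entry of [L]. The shift starts at
   [k = s - 1], which ties the chain to that entry. *)
pose l := last 0 L; pose d k := nth l L k.
pose f x := \row_(k < m)
  (d k * entry x k + (if (s <= k.+1)%N then entry x k.+1 else 0)).
have [|A fA] := @linear_mx F m m f.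
  move=> b x y; apply/rowP => k; rewrite !mxE !entryD !entryZ mulrDr mulrDr mulrCA.
  by case: ifP => _; rewrite ?mulr0 ?addr0 // addrACA.
exists A => a; rewrite -(card_positions a sL) -card_supported.
rewrite [in RHS](cardsD1 0) !inE.
have -> : [forall i, ((0 : 'rV[F]_m) ord0 i != 0) ==>
    (i \in [set i : 'I_m | (i < s)%N && (nth 0 L i == a)])].
  by apply/forallP => i; rewrite mxE eqxx.
rewrite add1n subn1; apply: eq_card => x; rewrite !inE; congr (_ && _).
rewrite fA; apply/eqP/forallP => [xA i|xS].
  have E k : (k < m)%N ->
      d k * entry x k + (if (s <= k.+1)%N then entry x k.+1 else 0) = a * entry x k.
    by move=> lt_km; have /rowP/(_ (Ordinal lt_km)) := xA; rewrite !mxE -entry_ord.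
  have d_tail k : (s.-1 <= k)%N -> d k = l.
    rewrite leq_eqVlt => /orP[/eqP <-|]; first by rewrite /d nth_last /l; case: (L) L0.
    by rewrite prednK // => lek; exact: nth_default.
  (* If [l = a], equation [k - 1] reduces to [x_k = 0]. Otherwise a descending induction from [m]
     turns equation [k] into [l x_k = a x_k]. *)
  have tail k : (s <= k)%N -> entry x k = 0.
    have [la|la] := eqVneq l a => lesk.
      have [lt_km|] := ltnP k m; last exact: entry_ge.
      have k0 : k = k.-1.+1 by rewrite prednK // (leq_trans s_gt0).
      have := E k.-1; rewrite -k0 lesk d_tail ?la; last by rewrite -!subn1 leq_sub2r.
      by move=> /(_ (ltnW lt_km)) /eqP; rewrite addrC -subr_eq0 addrK => /eqP.
    have [j] := ubnP (m - k); elim: j k lesk => // j IH k lesk ltj.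
    have [lt_km|] := ltnP k m; last exact: entry_ge.
    have := E k lt_km; rewrite leqW // (IH k.+1) ?leqW //; last by lia.
    rewrite addr0 d_tail ?(leq_trans (leq_pred _)) // => /eqP.
    by rewrite -subr_eq0 -mulrBl mulf_eq0 subr_eq0 (negPf la) => /eqP.
  apply/implyP; rewrite inE -entry_ord => xi.
  have lt_is : (i < s)%N by rewrite ltnNge; apply/negP => /tail/eqP; apply/negP.
  rewrite lt_is; have := E i (ltn_ord i).
  have -> : (if (s <= i.+1)%N then entry x i.+1 else 0) = 0 by case: ifP => // /tail.
  rewrite addr0 /d (set_nth_default 0) // => /eqP.
  by rewrite -subr_eq0 -mulrBl mulf_eq0 subr_eq0 (negPf xi) orbF.
have xP i : entry x i != 0 -> (i < s)%N /\ nth 0 L i = a.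
  have [lt_im|?] := ltnP i m; last by rewrite entry_ge ?eqxx.
  by have := xS (Ordinal lt_im); rewrite -entry_ord inE /= => /implyP h /h /andP[? /eqP].
apply/rowP => k; rewrite !mxE -entry_ord.
have -> : (if (s <= k.+1)%N then entry x k.+1 else 0) = 0.
  by case: ifP => // lek; case: (eqVneq (entry x k.+1) 0) => // /xP[]; rewrite ltnNge lek.
rewrite addr0; have [->|/xP[lt_ks <-]] := eqVneq (entry x k) 0; first by rewrite !mulr0.
by rewrite /d (set_nth_default 0).
Qed.

(** The map takes the value 0 at both 0 and 1, so it is not injective, hence not surjective on a
    finite field. *)
Lemma exists_nonval : (1 < m)%N -> exists c : F, forall a, a ^+ m - a ^+ m.-1 != c.
Proof.
move=> m_gt1; pose g (a : F) := a ^+ m - a ^+ m.-1.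
have [[c cP]|nc] := pselect (exists c, c \notin codom g).
  by exists c => a; apply: contraNneq cP => <-; exact: (codom_f g).
  have /eqP/image_injP g_inj : #|image_mem g (mem F)| = #|F|.
  by apply: eq_card => c; rewrite inE; apply/negPn/negP => cP; case: nc; exists c.
have := g_inj 0 1 isT isT.
rewrite /g !expr1n subrr !expr0n; case: (m) m_gt1 => [|[|k]] //= _.
by rewrite subr0 => /(_ erefl)/eqP; rewrite eq_sym oner_eq0.
Qed.

(* The companion matrix of [X^m - X^(m-1) - c], which has no root in [F]. *)
Lemma exists_mx_no_eigenvalue : (1 < m)%N -> exists A, num_eigenvectors A = 0%N.
Proof.
move=> m_gt1; have [c cP] := exists_nonval m_gt1.
pose f x := \row_(k < m) (entry x k.+1 +
  (if k.+1 == m then entry x k + c * entry x 0%N else 0)).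
have [|A fA] := @linear_mx F m m f.
  move=> b x y; apply/rowP => k; rewrite !mxE !entryD !entryZ !mulrDr.
  by case: ifP => _; ring.
exists A; apply: big1 => a _; apply: eq_card0 => x; rewrite inE.
apply/negP => /andP[/eqP x0 /eqP]; rewrite fA => /rowP xA; case: x0.
have E k : (k < m)%N -> entry x k.+1 +
    (if k.+1 == m then entry x k + c * entry x 0%N else 0) = a * entry x k.
  by move=> lt_km; have := xA (Ordinal lt_km); rewrite !mxE -entry_ord.
have P k : (k < m)%N -> entry x k = a ^+ k * entry x 0%N.
  elim: k => [|k IH] lt_km; first by rewrite mul1r.
  have := E k (ltnW lt_km); rewrite (ltn_eqF lt_km) addr0 => ->.
  by rewrite IH ?(ltnW lt_km) // exprS mulrA.
have m_gt0 := ltnW m_gt1.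
(* By [P], the last equation reads [a^(m-1) x_0 + c x_0 = a^m x_0]; a nonzero [x_0] would contradict
   [cP]. *)
have y0 : entry x 0%N = 0.
  have := E m.-1; rewrite prednK // eqxx entry_ge // P ?prednK // add0r.
  move=> /(_ (leqnn _))/eqP; rewrite mulrA -exprS prednK // -mulrDl.
  rewrite -subr_eq0 -mulrBl mulf_eq0 => /orP[|/eqP //].
  by rewrite subr_eq0 eq_sym addrC -subr_eq (negPf (cP a)).
by rewrite [x]row_entry; apply/rowP => k; rewrite !mxE P // y0 mulr0.
Qed.

(** Each entry [i] of [g] gets its own element of [e], repeated [i] times; leftover elements have
    multiplicity 0 and add nothing. The inclusion of [L] in [e] keeps the next element fresh in the
    induction. *)
Lemma exists_eigenvalue_list (e : seq F) g : uniq e -> (size g <= size e)%N ->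
  exists L, [/\ {subset L <= e}, size L = (\sum_(i <- g) i)%N &
    (\sum_(a <- e) (#|F| ^ count_mem a L - 1))%N = excess #|F| g].
Proof.
elim: g e => [|i g IH] e ue.
  by exists [::]; rewrite /excess !big_nil big1_seq // => a _; rewrite expn0.
case: e ue => // a e /= /andP[ae ue] /(IH _ ue)[L [Le sL eL]].
exists (nseq i a ++ L); split.
- move=> b; rewrite mem_cat mem_nseq inE => /orP[/andP[_ ->] //|/Le ->].
  by rewrite orbT.
- by rewrite size_cat size_nseq sL big_cons.
rewrite big_cons excess_cons -eL count_cat count_nseq /= eqxx mul1n.
have /count_memPn -> : a \notin L by apply: contra ae => /Le.
rewrite addn0; congr (_ + _)%N; apply: eq_big_seq => b be.
rewrite count_cat count_nseq /=; case: eqVneq => // ab.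
by rewrite ab be in ae.
Qed.

Lemma exists_eigenprofile g : (\sum_(i <- g) i <= m)%N -> all (ltn 0) g ->
  g != [::] -> sorted leq g -> (size g <= #|F|)%N ->
  exists A : 'M[F]_m, eigenprofile A = g.
Proof.
move=> sg pg g0 og lg.
have [|L [_ sL eL]] := exists_eigenvalue_list (enum_uniq F) (g := g).
  by rewrite -cardE.
have [||A AL] := @exists_mx_eigenvalues L; last 1 first.
- exists A; apply: eigenprofile_eq => //; rewrite -eL big_enum /=.
  exact: eq_bigr.
- rewrite -size_eq0 sL; case: (g) g0 pg => // i h _ /= /andP[i0 _].
  by rewrite big_cons addn_eq0 -leqn0 leqNgt i0.
by rewrite sL.
Qed.

End Realization.

(** * Weights of codewords *)

Section Flags.
Variables (F : finFieldType) (m : nat).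
Implicit Types (A : 'M[F]_m) (x y z : 'rV[F]_m).
Let q := #|F|.

(** Vectors are paired instead of points; the second condition already forces both to be nonzero. *)
Definition flags A := [set p : 'rV[F]_m * 'rV[F]_m |
  (p.1 *m p.2^T == 0) && (p.1 *m A *m p.2^T != 0)].

Lemma card_annihilator k (B : 'M[F]_(k, m)) :
  #|[set y : 'rV[F]_m | B *m y^T == 0]| = (q ^ (m - \rank B))%N.
Proof.
rewrite -mxrank_tr -mxrank_ker -card_submx; apply: eq_card => y.
by rewrite !inE sub_kermx -trmx_eq0 trmx_mul trmxK.
Qed.

(** From the annihilator of [x] one removes that of the plane spanned by [x] and [z]. *)
Lemma card_flag_fiber x z : (z <= x)%MS = false -> x != 0 ->
  #|[set y : 'rV[F]_m | (x *m y^T == 0) && (z *m y^T != 0)]| =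
  (q ^ (m - 1) - q ^ (m - 2))%N.
Proof.
move=> zx x0; have rx : \rank x = 1%N by rewrite rank_rV x0.
have rxz : \rank (col_mx x z) = 2%N.
  apply/eqP; rewrite eqn_leq rank_leq_row /= -[X in (X < _)%N]rx -addsmxE; apply: rank_ltmx.
  by rewrite /ltmx addsmxSl addsmx_sub zx andbF.
rewrite -[X in (m - X)%N]rx -card_annihilator -rxz -card_annihilator.
rewrite -[X in (X - _)%N](cardsID [set y : 'rV[F]_m | z *m y^T == 0]).
have -> : [set y : 'rV[F]_m | x *m y^T == 0] :&: [set y : 'rV[F]_m | z *m y^T == 0]
    = [set y : 'rV[F]_m | col_mx x z *m y^T == 0].
  by apply/finset.setP => y; rewrite !inE mul_col_mx col_mx_eq0.
by rewrite addKn; apply: eq_card => y; rewrite !inE andbC.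
Qed.

Lemma card_flags A :
  #|flags A| = ((q ^ m - (num_eigenvectors A).+1) * (q ^ (m - 1) - q ^ (m - 2)))%N.
Proof.
rewrite -card_eigenlines -sum1_card.
pose Q x y := (x *m y^T == 0) && (x *m A *m y^T != 0).
rewrite (eq_bigl (fun p => predT p.1 && Q p.1 p.2)); last by move=> p; rewrite inE.
rewrite -(pair_big_dep predT Q (fun _ _ => 1%N)) /=.
(* Zero and the eigenvectors have empty fibres; all other vectors have fibres of the same size. *)
rewrite (bigID (fun x => (x *m A <= x)%MS)) /= big1 => [|x /sub_rVP[a xA]].
  rewrite add0n (eq_bigr (fun _ => q ^ (m - 1) - q ^ (m - 2))%N) => [|x nx].
    rewrite sum_nat_const; congr (_ * _)%N.
    have -> : (q ^ m)%N = #|{: 'rV[F]_m}| by rewrite card_mx mul1n.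
    rewrite -(cardC [set x : 'rV[F]_m | (x *m A <= x)%MS]) addKn.
    by apply: eq_card => x; rewrite !inE.
  rewrite -(@card_flag_fiber x (x *m A)) ?(negPf nx) //.
    by rewrite -sum1_card; apply: eq_bigl => y; rewrite inE.
  by apply: contraNneq nx => ->; rewrite mul0mx sub0mx.
rewrite big_pred0 // => y; apply/negP => /andP[/eqP xy].
by rewrite xA -scalemxAl xy scaler0 eqxx.
Qed.

Lemma num_eigenvectors_lt A : (num_eigenvectors A < q ^ m)%N.
Proof.
rewrite -card_eigenlines; apply: leq_trans (max_card _) _.
by rewrite card_mx mul1n.
Qed.

(** The bound [1 < m] makes the common factor positive, and [num_eigenvectors_lt] keeps the
    subtraction from truncating. *)
Lemma card_flags_inj A B : (1 < m)%N -> #|flags A| = #|flags B| ->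
  num_eigenvectors A = num_eigenvectors B.
Proof.
move=> m_gt1; rewrite !card_flags => /eqP; rewrite eqn_pmul2r; last first.
  by rewrite subn_gt0 ltn_exp2l ?finalg.card_finNzRing_gt1 //; lia.
have := num_eigenvectors_lt A; have := num_eigenvectors_lt B.
by move=> ? ? /eqP; lia.
Qed.

(** The contragredient action, [g] on [x] and the inverse transpose on [y], preserves [x y^T] and
    carries the flags of [A] to those of its conjugate. *)
Lemma card_flags_conj A (g : 'M[F]_m) : g \in unitmx ->
  #|flags (invmx g *m A *m g)| = #|flags A|.
Proof.
move=> gU; pose h (p : 'rV[F]_m * 'rV[F]_m) := (p.1 *m g, p.2 *m (invmx g)^T).
have gTU : (invmx g)^T \in unitmx by rewrite unitmx_tr unitmx_inv.
have h_inj : injective h.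
  move=> [x y] [x' y'] [] /(can_inj (mulmxK gU)) -> /(can_inj (mulmxK gTU)) ->.
  by [].
rewrite -(card_imset (flags A) h_inj); apply: eq_card => -[x y].
have E (z w : 'rV[F]_m) (B : 'M[F]_m) : z *m g *m (invmx g *m B *m g) *m (w *m (invmx g)^T)^T
    = z *m B *m w^T.
  by rewrite trmx_mul trmxK !mulmxA !mulmxK // mulmxK.
have E1 (z w : 'rV[F]_m) : z *m g *m (w *m (invmx g)^T)^T = z *m w^T.
  by rewrite trmx_mul trmxK mulmxA mulmxK.
apply/idP/imsetP => [|[[z w] zw [-> ->]]]; last first.
  by move: zw; rewrite !inE /= E E1.
have -> : x = x *m invmx g *m g by rewrite mulmxKV.
have -> : y = y *m invmx (invmx g)^T *m (invmx g)^T by rewrite mulmxKV.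
move: (x *m invmx g) (y *m _) => z w zw; exists (z, w) => //.
by move: zw; rewrite !inE /= E E1.
Qed.

End Flags.

(** * Hamming weights in terms of flags *)

Section Codewords.
Variables (F : finFieldType) (m N : nat) (X Y : 'I_N -> 'rV[F]_m).
Implicit Types (A : 'M[F]_m) (x y z : 'rV[F]_m).

Definition codeword A : 'rV[F]_N := \row_j (X j *m A *m (Y j)^T) ord0 ord0.

Lemma codeword_linear : linear codeword.
Proof.
move=> a A B; apply/rowP => j; rewrite [LHS]mxE mulmxDr mulmxDl.
by rewrite -scalemxAr -scalemxAl !mxE.
Qed.

HB.instance Definition _ := GRing.isLinear.Build F _ _ _ codeword codeword_linear.

(** Together the hypotheses say that the pairs [(X j, Y j)] represent every incident pair of a point
    and a hyperplane exactly once. *)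
Hypothesis X_neq0 : forall j, X j != 0.
Hypothesis Y_neq0 : forall j, Y j != 0.
Hypothesis XY : forall j, X j *m (Y j)^T = 0.
Hypothesis XY_inj : forall i j a b, X j = a *: X i -> Y j = b *: Y i -> i = j.
Hypothesis XY_surj : forall x y, x != 0 -> y != 0 -> x *m y^T = 0 ->
  exists j a b, x = a *: X j /\ y = b *: Y j.

(** A nonzero position [j] yields the flags [(a X_j, b Y_j)] with [a], [b] nonzero, and every flag
    arises once in this way. *)
Lemma hamming_weight_codeword A :
  (hamming_weight (codeword A) * (#|F| - 1) ^ 2)%N = #|flags A|.
Proof.
pose D := finset.setX (finset.setX [set j | codeword A ord0 j != 0] [set~ (0 : F)]) [set~ (0 : F)].
pose h (t : 'I_N * F * F) := (t.1.2 *: X t.1.1, t.2 *: Y t.1.1).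
have -> : (hamming_weight (codeword A) * (#|F| - 1) ^ 2)%N = #|D|.
  rewrite /D !cardsX cardsC1 -subn1 -mulnA; congr (_ * _)%N.
have scal_inj (a b : F) x : x != 0 -> a *: x = b *: x -> a = b.
  move=> x0 /eqP; rewrite -subr_eq0 -scalerBl scaler_eq0 (negPf x0) orbF.
  by rewrite subr_eq0 => /eqP.
have h_inj : {in D &, injective h}.
  move=> [[i a] b] [[j c] d]; rewrite !inE /= => /andP[/andP[_ a0] b0].
  move=> /andP[/andP[_ c0] d0] [e1 e2].
  have ij : i = j.
    apply: (@XY_inj _ _ (c^-1 * a) (d^-1 * b)).
      by rewrite -scalerA e1 scalerA mulVf ?scale1r.
    by rewrite -scalerA e2 scalerA mulVf ?scale1r.
  by subst j; rewrite (scal_inj _ _ _ (X_neq0 i) e1) (scal_inj _ _ _ (Y_neq0 i) e2).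
rewrite -(card_in_imset h_inj); apply: eq_card => -[x y].
have scal (a b : F) i (B : 'M[F]_m) : (a *: X i) *m B *m (b *: Y i)^T =
    (a * b) *: (X i *m B *m (Y i)^T).
  by rewrite linearZ /= -scalemxAr -!scalemxAl scalerA mulrC.
have scal1 (a b : F) i : (a *: X i) *m (b *: Y i)^T = 0.
  by have := scal a b i 1%:M; rewrite !mulmx1 XY scaler0.
have nz j : (X j *m A *m (Y j)^T == 0) = (codeword A ord0 j == 0).
  rewrite mxE; apply/eqP/eqP => [->|e]; first by rewrite mxE.
  by apply/matrixP => i k; rewrite !ord1 e mxE.
apply/imsetP/idP => [[[[i a] b]]|].
  rewrite !inE /= => /andP[/andP[ci a0] b0] [-> ->].
  rewrite scal scal1 eqxx scaler_eq0 nz mulf_eq0 (negPf a0) (negPf b0).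
  exact: ci.
rewrite inE /= => /andP[/eqP xy xAy].
have x0 : x != 0 by apply: contraNneq xAy => ->; rewrite !mul0mx.
have y0 : y != 0 by apply: contraNneq xAy => ->; rewrite trmx0 mulmx0.
have [j [a [b [xE yE]]]] := XY_surj x0 y0 xy.
exists ((j, a), b); last by rewrite /h /= xE yE.
move: xAy x0 y0; rewrite xE yE scal !scaler_eq0 nz !negb_or mulf_eq0 negb_or.
by rewrite !inE /= => /andP[/andP[-> ->] ->].
Qed.

Lemma hamming_weight_eq A B : (hamming_weight (codeword A) == hamming_weight (codeword B))
  = (#|flags A| == #|flags B|).
Proof.
rewrite -!hamming_weight_codeword eqn_pmul2r // expn_gt0 subn_gt0.
by rewrite finalg.card_finNzRing_gt1.
Qed.

Lemma hamming_weight_num_eigenvectors A B : (1 < m)%N ->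
  (hamming_weight (codeword A) = hamming_weight (codeword B)) <->
  (num_eigenvectors A = num_eigenvectors B).
Proof.
move=> m_gt1; split=> [/eqP|e].
  by rewrite hamming_weight_eq => /eqP; apply: card_flags_inj.
by apply/eqP; rewrite hamming_weight_eq !card_flags e.
Qed.

(** [None] marks the matrices without eigenvalue in [F], hence the largest weight; weight zero
    belongs to the scalar matrices, with profile [[:: m]]. *)
Definition code_profile A : option (seq nat) :=
  if eigenprofile A is [::] then None else Some (eigenprofile A).

(* The weight of the codeword of [A] and the profile of [A] both determine the
   number of eigenvectors of [A], and are determined by it. *)
Lemma code_weights_profiles (n : nat) (C : {vspace 'rV[F]_N}) : m = n.+1 -> (1 <= n)%N ->
  (forall c, c \in C <-> exists A, c = codeword A) ->
  exists f : nat -> option (seq nat), set_bij (code_weights C)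
     (Some @` profiles #|F| n `|` [set None])%classic f.
Proof.
move=> mn n_gt0 CP; have m_gt1 : (1 < m)%N by rewrite mn.
(* Any matrix of the given weight is picked; [fE] shows that the choice does not matter. *)
pose f w := if [pick A | hamming_weight (codeword A) == w] is Some A
  then code_profile A else None.
have fE A : f (hamming_weight (codeword A)) = code_profile A.
  rewrite /f; case: pickP => [B /eqP /(hamming_weight_num_eigenvectors _ _ m_gt1) e|];
    last by move=> /(_ A); rewrite eqxx.
  rewrite /code_profile (@eigenprofile_eq _ _ B (eigenprofile A)) //.
  - exact: eigenprofile_sorted.
  - exact: eigenprofile_gt0.
  - exact: size_eigenprofile.
  - by rewrite e num_eigenvectorsE.
exists f; split.
- move=> w [c /CP[A ->] <-]; rewrite fE /code_profile.
  case E : (eigenprofile A) => [|i g]; first by right.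
  left; exists (i :: g) => //; rewrite -E; split.
  + by rewrite -mn sumn_eigenprofile.
  + apply/allP => d dA; rewrite [(0 < d)%N](allP (eigenprofile_gt0 A) d dA) -mn.
    apply: leq_trans (sumn_eigenprofile A).
    by rewrite (big_rem d) //= leq_addr.
  + exact: eigenprofile_sorted.
  + by rewrite size_eigenprofile E.
- move=> w w' /set_mem[c /CP[A ->] <-] /set_mem[c' /CP[B ->] <-].
  rewrite !fE => e; apply/(hamming_weight_num_eigenvectors _ _ m_gt1).
  rewrite !num_eigenvectorsE; congr excess.
  move: e; rewrite /code_profile; case: (eigenprofile A) => [|i g].
    by case: (eigenprofile B).
  by case: (eigenprofile B) => // j h [-> ->].
- have img A : ((f @` code_weights C) (code_profile A))%classic.
    exists (hamming_weight (codeword A)); last exact: fE.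
    by exists (codeword A) => //; apply/CP; exists A.
  move=> _ [[g [sg pg og /andP[g0 lg]] <-]|->].
    rewrite -mn in sg; have [||A Ag] := exists_eigenprofile sg _ _ og lg.
    + by apply: sub_all pg => i /andP[].
    + by case: (g) g0.
    have := img A; rewrite /code_profile Ag.
    by case: (g) g0.
  have [A Ag] := exists_mx_no_eigenvalue F m_gt1.
  have := img A; rewrite /code_profile (@eigenprofile_eq _ _ A [::]) //.
  by rewrite Ag /excess big_nil.
Qed.

End Codewords.

(** * Coordinates *)

Section CodeFunctionals.
Variables (F : finFieldType) (W : vectType F) (N : nat) (v : 'I_N -> W).

Definition evaluation (phi : 'Hom(W, F^o)) : 'rV[F]_N := \row_j phi (v j).

Lemma evaluation_linear : linear evaluation.
Proof.
by move=> a f g; apply/rowP => j; rewrite !mxE add_lfunE scale_lfunE.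
Qed.

HB.instance Definition _ := GRing.isLinear.Build F _ _ _ evaluation evaluation_linear.

(** The rows of the generator matrix are the evaluations of the coordinate functionals, and these
    span all functionals. *)
Lemma code_evaluation c : c \in code v <-> exists phi, c = evaluation phi.
Proof.
split=> [|[phi ->]].
  have : (code v <= limg (linfun evaluation))%VS.
    apply/span_subvP => _ /fintype.imageP[i _ ->].
    apply/memv_imgP; exists (linfun (coord (vbasis {:W}) i : W -> F^o)); rewrite ?memvf //.
    by rewrite lfunE; apply/rowP => j; rewrite !mxE lfunE.
  move=> cv cC; have /memv_imgP[phi _ ->] := subvP cv c cC.
  by exists phi; rewrite lfunE.
have -> : evaluation phi =
    \sum_(i < \dim {:W}) phi (vbasis {:W})`_i *: row i (generator_matrix v).
  apply/rowP => j; rewrite mxE {1}(coord_vbasis (memvf (v j))) linear_sum summxE.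
  by apply: eq_bigr => i _; rewrite linearZ !mxE mulrC.
by apply: memv_suml => i _; apply/memvZ/memv_span/fintype.image_f.
Qed.

End CodeFunctionals.

Section Coordinates.
Variables (F : fieldType) (V : vectType F) (m : nat) (e : m.-tuple V).
Hypothesis e_basis : basis_of {:V} e.
Implicit Types (u : V) (w : dual V) (x y : 'rV[F]_m).

Definition vec_row u : 'rV[F]_m := \row_i coord e i u.
Definition dual_row w : 'rV[F]_m := \row_i w e`_i.
Definition row_vec x : V := \sum_i x ord0 i *: e`_i.

Lemma vec_rowE u : u = \sum_i vec_row u ord0 i *: e`_i.
Proof.
rewrite {1}(coord_basis e_basis (memvf u)).
by apply: eq_bigr => i _; rewrite mxE.
Qed.

Lemma row_vecK x : vec_row (row_vec x) = x.
Proof.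
by apply/rowP => i; rewrite mxE coord_sum_free // (basis_free e_basis).
Qed.

Lemma vec_row_linear : linear vec_row.
Proof. by move=> a u v; apply/rowP => i; rewrite !mxE linearP. Qed.

Lemma dual_row_linear : linear dual_row.
Proof.
by move=> a w z; apply/rowP => i; rewrite !mxE add_lfunE scale_lfunE.
Qed.

HB.instance Definition _ := GRing.isLinear.Build F _ _ _ vec_row vec_row_linear.
HB.instance Definition _ := GRing.isLinear.Build F _ _ _ dual_row dual_row_linear.

Lemma vec_row_inj : injective vec_row.
Proof. by move=> u u' uu'; rewrite (vec_rowE u) uu' -vec_rowE. Qed.

Lemma dual_rowE w u : w u = (vec_row u *m (dual_row w)^T) ord0 ord0.
Proof.
rewrite {1}(vec_rowE u) linear_sum mxE.
by apply: eq_bigr => i _; rewrite linearZ !mxE.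
Qed.

Lemma dual_row_inj : injective dual_row.
Proof. by move=> w w' ww'; apply/lfunP => u; rewrite !dual_rowE ww'. Qed.

Lemma dual_row_surj y : exists w, dual_row w = y.
Proof.
pose f u : F^o := (vec_row u *m y^T) ord0 ord0.
have f_lin : linear f.
  by move=> a u v; rewrite /f linearP mulmxDl -scalemxAl !mxE.
pose fL := HB.pack f (GRing.isLinear.Build F _ _ _ f f_lin) : {linear V -> F^o}.
exists (linfun fL); apply/rowP => i; rewrite mxE lfunE /= /f mxE (bigD1 i) //= big1.
  by rewrite !mxE coord_free ?(basis_free e_basis) // eqxx mul1r addr0.
move=> k ki; rewrite !mxE coord_free ?(basis_free e_basis) //.
by rewrite eq_sym (negPf ki) mul0r.
Qed.

(** This comes from the universal property, and serves to recover the two factors of a pure tensor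
    up to scalars. *)
Lemma tens_row : exists T : 'Hom(tensor V (dual V), 'M[F]_m),
  forall u w, T (tens u w) = (vec_row u)^T *m dual_row w.
Proof.
have [w|u|T [TE _]] := @tens_universal F V (dual V) 'M[F]_m
    (fun u w => (vec_row u)^T *m dual_row w).
- by move=> a u u'; rewrite !linearP mulmxDl -scalemxAl.
- by move=> a w w'; rewrite linearP mulmxDr -scalemxAr.
by exists T.
Qed.

Lemma tens_functional (phi : 'Hom(tensor V (dual V), F^o)) :
  exists A : 'M[F]_m, forall u w,
    phi (tens u w) = (vec_row u *m A *m (dual_row w)^T) ord0 ord0.
Proof.
(* [d] is the basis dual to [e]; the matrix of [phi] holds its values on the tensors of basis
   vectors. *)
have [d dE] := choice (fun k : 'I_m => dual_row_surj (delta_mx ord0 k)).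
exists (\matrix_(i, k) phi (tens e`_i (d k))) => u w.
pose tL w' := HB.pack (fun u' => tens u' w')
  (GRing.isLinear.Build F _ _ _ _ (tens_linear_l w')) : {linear V -> tensor V (dual V)}.
pose tR u' := HB.pack (tens u')
  (GRing.isLinear.Build F _ _ _ _ (tens_linear_r u')) :
  {linear dual V -> tensor V (dual V)}.
have wE : w = \sum_k dual_row w ord0 k *: d k.
  apply: dual_row_inj; rewrite linear_sum [LHS]row_sum_delta.
  by apply: eq_bigr => k _; rewrite linearZ /= dE.
have L u' : phi (tens u' w) = \sum_k dual_row w ord0 k * phi (tens u' (d k)).
  rewrite {1}wE -[tens u' _]/(tR u' _) !linear_sum.
  by apply: eq_bigr => k _; rewrite !linearZ.
rewrite mxE L; apply: eq_bigr => k _.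
rewrite [RHS]mulrC [in RHS]mxE; congr (_ * _).
rewrite {1}(vec_rowE u) -[tens _ _]/(tL _ _) !linear_sum mxE.
by apply: eq_bigr => i _; rewrite !linearZ !mxE.
Qed.

Lemma functional_tens (A : 'M[F]_m) :
  exists phi : 'Hom(tensor V (dual V), F^o), forall u w,
    phi (tens u w) = (vec_row u *m A *m (dual_row w)^T) ord0 ord0.
Proof.
have [w|u|phi [phiE _]] := @tens_universal F V (dual V) F^o
    (fun u w => (vec_row u *m A *m (dual_row w)^T) ord0 ord0).
- by move=> a u u'; rewrite linearP !mulmxDl -!scalemxAl !mxE.
- by move=> a w w'; rewrite linearP /= linearP /= mulmxDr -scalemxAr !mxE.
by exists phi.
Qed.

Lemma rank1_inj x y x' y' (c : F) : x != 0 -> y != 0 ->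
  x^T *m y = c *: (x'^T *m y') -> exists a b, x = a *: x' /\ y = b *: y'.
Proof.
move=> /rV0Pn[i xi] /rV0Pn[k yk] /matrixP e0.
have E j l : x ord0 j * y ord0 l = c * (x' ord0 j * y' ord0 l).
  by have := e0 j l; rewrite !mxE !big_ord1 !mxE.
(* The scalars come from comparing column [k] and row [i], where [y] and [x] do not vanish. *)
exists (c * y' ord0 k / y ord0 k), (c * x' ord0 i / x ord0 i); split; apply/rowP => j.
  by apply: (mulIf yk); rewrite E !mxE; field.
by apply: (mulfI xi); rewrite E !mxE; field.
Qed.

End Coordinates.

(** This reduces the projective system to the row vectors and hypotheses under which weights and
    automorphisms are studied. *)
Lemma Lambda1_coordinates (F : finFieldType) (V : vectType F) (m N : nat)
    (v : 'I_N -> tensor V (dual V)) :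
  \dim {:V} = m -> representatives (@Lambda1 F V) v ->
  exists X Y : 'I_N -> 'rV[F]_m,
    [/\ [/\ forall j, X j != 0, forall j, Y j != 0 & forall j, X j *m (Y j)^T = 0],
        forall i j a b, X j = a *: X i -> Y j = b *: Y i -> i = j,
        forall x y, x != 0 -> y != 0 -> x *m y^T = 0 ->
          exists j a b, x = a *: X j /\ y = b *: Y j
      & forall c, c \in code v <-> exists A, c = codeword X Y A].
Proof.
move=> <- {m} [v0 v_inj vP]; pose e := vbasis {:V}.
have e_basis : basis_of {:V} e := vbasisP _.
have /choice[xw xwP] : forall j, exists p : V * dual V,
    [/\ p.1 != 0, p.2 != 0, p.2 p.1 = 0 & v j = tens p.1 p.2].
  move=> j; have [|x [w [x0 w0 wx vE]]] := (vP <[v j]>%VS).2; first by exists j.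
  (* [v j] is only a multiple of a pure tensor; the scalar is absorbed into the first factor. *)
  have : v j \in <[tens x w]>%VS by rewrite -vE memv_line.
  case/vlineP => a vj; exists (a *: x, w) => /=; split=> //.
  - apply: contraNneq (v0 j); rewrite vj => /eqP; rewrite scaler_eq0 (negPf x0) orbF.
    by move=> /eqP ->; rewrite scale0r.
  - by rewrite linearZ /= wx scaler0.
  - by rewrite vj; apply/matrixP => k l; rewrite !mxE linearZ /= mulrA.
have [T TE] := tens_row e.
exists (fun j => vec_row e (xw j).1), (fun j => dual_row e (xw j).2).
have row0 u : (vec_row e u == 0) = (u == 0).
  by rewrite -(linear0 (vec_row e)) (inj_eq (vec_row_inj e_basis)).
have drow0 w : (dual_row e w == 0) = (w == 0).
  by rewrite -(linear0 (dual_row e)) (inj_eq (dual_row_inj e_basis)).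
have mx11 (M : 'M[F]_1) : M ord0 ord0 = 0 -> M = 0.
  by move=> M0; apply/matrixP => i j; rewrite !ord1 M0 mxE.
split.
- split=> j; have [x0 w0 wx _] := xwP j; rewrite ?row0 ?drow0 //.
  by apply: mx11; rewrite -dual_rowE.
- move=> i j a b; rewrite -!linearZ => /(vec_row_inj e_basis) xE /(dual_row_inj e_basis) wE.
  apply: v_inj; have [_ _ _ vi] := xwP i; have [_ _ _ vj] := xwP j.
  have vjE : v j = (a * b) *: v i.
    by rewrite vj vi xE wE; apply/matrixP => k l; rewrite !mxE !linearZ /=; ring.
  apply/esym/eqP; rewrite eqEdim !dim_vline !v0 leqnn andbT -memvE vjE.
  by rewrite memvZ ?memv_line.
- move=> x y x0 y0 xy; pose u := row_vec e x; have [w wE] := dual_row_surj e_basis y.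
  have uE : vec_row e u = x := row_vecK e_basis x.
  have [|j jE] := (vP <[tens u w]>%VS).1.
    exists u, w; split=> //; rewrite -?row0 -?drow0 ?uE ?wE //.
    by rewrite (dual_rowE e_basis) uE wE xy mxE.
  (* [T] turns proportional tensors into proportional rank-one matrices, whose factors [rank1_inj]
     separates. *)
  have : tens u w \in <[v j]>%VS by rewrite -jE memv_line.
  case/vlineP => c cE; have [_ _ _ vj] := xwP j; exists j.
  apply: (@rank1_inj _ _ _ _ _ _ c) => //.
  by rewrite -uE -wE -!TE cE linearZ /= vj.
- move=> c; split=> [/code_evaluation[phi ->]|[A ->]].
    have [A AE] := tens_functional e_basis phi; exists A; apply/rowP => j.
    by rewrite [LHS]mxE [RHS]mxE; have [_ _ _ ->] := xwP j; rewrite AE.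
  have [phi phiE] := functional_tens e A; apply/code_evaluation; exists phi.
  by apply/rowP => j; rewrite [RHS]mxE; have [_ _ _ ->] := xwP j; rewrite phiE mxE.
Qed.

(** * Automorphisms *)

Section LiftAction.
Variables (F : finFieldType) (N : nat) (C : {vspace 'rV[F]_N}).

(** Elements of [code_aut C] fix everything outside [C]. *)
Lemma code_aut_ext s t : s \in code_aut C -> t \in code_aut C ->
  {in C, s =1 t} -> s = t.
Proof.
rewrite !inE => /and3P[sC _ _] /and3P[tC _ _] st; apply/permP => c.
have [/st //|cC] := boolP (c \in C).
by rewrite (out_perm sC) ?(out_perm tC) // inE.
Qed.

(** [M] parametrises the code through [w]; a linear right action on [M] that preserves weights is
    pushed forward to [C]. *)
Variables (M : lmodType F) (w : {linear M -> 'rV[F]_N}).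
Hypothesis CP : forall c, c \in C <-> exists A, c = w A.
Variables (gT : finGroupType) (rho : gT -> M -> M).
Hypothesis rho_linear : forall g, linear (rho g).
Hypothesis rho1 : forall A, rho 1%g A = A.
Hypothesis rhoM : forall g h A, rho (g * h)%g A = rho h (rho g A).
Hypothesis rho_weight : forall g A, hamming_weight (w (rho g A)) = hamming_weight (w A).

Lemma hamming_weight_eq0 (c : 'rV[F]_N) : (hamming_weight c == 0)%N = (c == 0).
Proof.
apply/idP/eqP => [|->].
  rewrite cards_eq0 => /eqP/finset.setP c0; apply/rowP => j; rewrite mxE.
  by have := c0 j; rewrite !inE => /negbFE/eqP.
by rewrite cards_eq0; apply/eqP/finset.setP => j; rewrite !inE mxE eqxx.
Qed.

(** A preimage under [w] is chosen on [C]; off [C] the action is trivial, as [code_aut] requires. *)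
Definition lift_act c g : 'rV[F]_N :=
  if pselect (exists A, c = w A) is left e then w (rho g (projT1 (cid e))) else c.

(* [rho g] preserves the kernel of [w], which consists of the elements whose
   image has weight zero. *)
Lemma lift_actE A g : lift_act (w A) g = w (rho g A).
Proof.
rewrite /lift_act; case: pselect => [e|[]]; last by exists A.
case: cid => B /= AB; apply/eqP; rewrite eq_sym -subr_eq0.
have rhoB : rho g A - rho g B = rho g (A - B).
  have -> : A - B = -1 *: B + A by rewrite scaleN1r addrC.
  by rewrite rho_linear scaleN1r addrC.
rewrite -linearB rhoB -hamming_weight_eq0 rho_weight hamming_weight_eq0.
by rewrite linearB -AB subrr.
Qed.

Lemma lift_act_out c g : c \notin C -> lift_act c g = c.
Proof.
by move=> cC; rewrite /lift_act; case: pselect => // e; case/negP: cC; apply/CP.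
Qed.

Lemma lift_act1 : lift_act^~ 1%g =1 id.
Proof.
move=> c; have [/CP[A ->]|/lift_act_out ->//] := boolP (c \in C).
by rewrite lift_actE rho1.
Qed.

Lemma lift_actM c : act_morph lift_act c.
Proof.
move=> g h; have [/CP[A ->]|cC] := boolP (c \in C).
  by rewrite !lift_actE rhoM.
by rewrite !lift_act_out.
Qed.

Definition lift_action := TotalAction lift_act1 lift_actM.

Lemma lift_code_aut : exists f : {morphism [set: gT] >-> {perm 'rV[F]_N}},
  (forall g A, f g (w A) = w (rho g A)) /\ (f @* [set: gT] \subset code_aut C)%g.
Proof.
exists (actperm_morphism lift_action); have E g c : actperm lift_action g c = lift_act c g.
  by rewrite actpermE.
split=> [g A|]; first by rewrite /= E lift_actE.
apply/fintype.subsetP => _ /morphimP[g _ _ ->]; rewrite inE; apply/and3P; split.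
- apply/fintype.subsetP => c; rewrite !inE /= E; apply: contraNT => cC.
  by rewrite lift_act_out.
- apply/forallP => a; apply/forall_inP => _ /CP[A ->]; apply/forall_inP => _ /CP[B ->].
  by rewrite -linearP /= !E !lift_actE rho_linear linearP.
- by apply/forall_inP => _ /CP[A ->]; rewrite /= E lift_actE rho_weight.
Qed.

End LiftAction.

(** * Scalar matrices and elementary matrices *)

Section Scalars.
Variables (F : fieldType) (n : nat).
Implicit Types B : 'M[F]_n.+2.

Lemma mul_delta_mxE p r t (i : 'I_p) (j : 'I_r) (B : 'M[F]_(r, t)) k l :
  (delta_mx i j *m B) k l = (k == i)%:R * B j l.
Proof.
rewrite mxE (bigD1 j) //= big1 => [|a aj]; first by rewrite mxE eqxx andbT addr0.
by rewrite mxE (negPf aj) andbF mul0r.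
Qed.

Lemma mul_mx_deltaE p r t (i : 'I_r) (j : 'I_t) (B : 'M[F]_(p, r)) k l :
  (B *m delta_mx i j) k l = B k i * (l == j)%:R.
Proof.
rewrite mxE (bigD1 i) //= big1 => [|a aj]; first by rewrite mxE eqxx addr0.
by rewrite mxE (negPf aj) mulr0.
Qed.

(** Entry [(i, j)] of the commutation gives [B_jj = B_ii], and entry [(i, l)] with [l] other than
    [j] gives [B_jl = 0]. *)
Lemma comm_delta_scalar B :
  (forall i j : 'I_n.+2, i != j -> delta_mx i j *m B = B *m delta_mx i j) ->
  B = (B ord0 ord0)%:M.
Proof.
move=> BC; apply/matrixP => j l; rewrite mxE.
have diag i : B i i = B ord0 ord0.
  have [-> //|i0] := eqVneq i ord0.
  have /matrixP/(_ i ord0) := BC _ _ i0.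
  by rewrite mul_delta_mxE mul_mx_deltaE !eqxx mul1r mulr1.
have [->|jl] := eqVneq j l; first by rewrite diag mulr1n.
have [i ij] : exists i, i != j by exists (lift j ord0); rewrite eq_sym neq_lift.
have /matrixP/(_ i l) := BC _ _ ij.
by rewrite mul_delta_mxE mul_mx_deltaE eqxx mul1r [l == j]eq_sym (negPf jl) mulr0.
Qed.

(** The inverse is [1 - E_ij], since [E_ij] squares to 0. *)
Lemma delta_mx_unit i j : i != j :> 'I_n.+2 -> 1%:M + delta_mx i j \in @unitmx F n.+2.
Proof.
move=> ij; have [] // := @mulmx1_unit F _ (1%:M + delta_mx i j) (1%:M - delta_mx i j).
rewrite mulmxBr mulmx1 mulmxDl mul1mx mul_delta_mx_0 1?eq_sym //.
by rewrite addr0 addrK.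
Qed.

(* If [g^-1 E g = E + s] with [E ^+ 2 = 0], then [0 = (E + s) ^+ 2], and the
   diagonal entries give [s ^+ 2 = 0]. *)
Lemma conj_delta_comm (g : 'M[F]_n.+2) (i j : 'I_n.+2) s : g \in unitmx -> i != j ->
  invmx g *m delta_mx i j *m g - delta_mx i j = s%:M ->
  delta_mx i j *m g = g *m delta_mx i j.
Proof.
move=> gU ij; set E := delta_mx i j => /eqP; rewrite subr_eq => /eqP eP.
have E2 : E *m E = 0 by rewrite mul_delta_mx_0 // eq_sym.
have : (s%:M + E) *m (s%:M + E) = 0.
  by rewrite -eP !mulmxA (mulmxK gU) -[_ *m E *m E]mulmxA E2 mulmx0 mul0mx.
rewrite mulmxDl !mulmxDr E2 addr0 !mul_mx_scalar mul_scalar_mx => /matrixP/(_ i i).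
rewrite !mxE eqxx /= (negPf ij) !mulr0 !addr0 mulr1n => /eqP.
rewrite mulf_eq0 orbb => /eqP s0.
rewrite s0 raddf0 add0r in eP.
by rewrite -[LHS](mulKVmx gU) [invmx g *m (E *m g)]mulmxA eP.
Qed.

End Scalars.

(** * Conjugations and scalar multiplications acting on the code *)

Section Automorphisms.
Variables (F : finFieldType) (n N : nat) (X Y : 'I_N -> 'rV[F]_n.+2).
Hypothesis X_neq0 : forall j, X j != 0.
Hypothesis Y_neq0 : forall j, Y j != 0.
Hypothesis XY : forall j, X j *m (Y j)^T = 0.
Hypothesis XY_inj : forall i j a b, X j = a *: X i -> Y j = b *: Y i -> i = j.
Hypothesis XY_surj : forall x y, x != 0 -> y != 0 -> x *m y^T = 0 ->
  exists j a b, x = a *: X j /\ y = b *: Y j.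
Variable C : {vspace 'rV[F]_N}.
Hypothesis CP : forall c, c \in C <-> exists A, c = codeword X Y A.
Let cw : {linear 'M[F]_n.+2 -> 'rV[F]_N} := codeword X Y.

(** The flags [(e_i, e_k)] kill the off-diagonal entries, and [(e_i + e_k, e_i - e_k)] then equates
    the diagonal ones. *)
Lemma codeword_eq0 (B : 'M[F]_n.+2) : codeword X Y B = 0 -> exists s, B = s%:M.
Proof.
move=> /rowP B0.
have B_flag (x y : 'rV[F]_n.+2) : x *m y^T = 0 -> x *m B *m y^T = 0.
  have [->|x0] := eqVneq x 0; first by rewrite !mul0mx.
  have [->|y0] := eqVneq y 0; first by rewrite trmx0 !mulmx0.
  move=> /(XY_surj x0 y0)[j [a [b [-> ->]]]].
  rewrite linearZ /= -scalemxAr -!scalemxAl.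
  have -> : X j *m B *m (Y j)^T = 0.
    by apply/matrixP => i k; rewrite !ord1; have := B0 j; rewrite !mxE.
  by rewrite !scaler0.
have entryE (i k : 'I_n.+2) : delta_mx ord0 i *m B *m (delta_mx ord0 k)^T =
    (B i k)%:M :> 'M[F]_1.
  rewrite -rowE trmx_delta -colE; apply/matrixP => ? ?.
  by rewrite !ord1 !mxE eqxx mulr1n.
have off i k : i != k -> B i k = 0.
  move=> ik; have := B_flag (delta_mx ord0 i) (delta_mx ord0 k).
  rewrite entryE trmx_delta mul_delta_mx_0 // => /(_ erefl)/matrixP/(_ ord0 ord0).
  by rewrite !mxE mulr1n.
have diag i k : B i i = B k k.
  have [-> //|ik] := eqVneq i k.
  have ki : k != i by rewrite eq_sym.
  have orth : (delta_mx ord0 i + delta_mx ord0 k) *m (delta_mx ord0 i - delta_mx ord0 k)^T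
      = 0 :> 'M[F]_1.
    rewrite linearB /= mulmxDl !mulmxBr !trmx_delta !mul_delta_mx.
    by rewrite !mul_delta_mx_0 // subr0 sub0r subrr.
  have := B_flag _ _ orth; rewrite linearB /= !mulmxDl !mulmxBr !entryE.
  move=> /matrixP/(_ ord0 ord0); rewrite !mxE eqxx !mulr1n (off i k) // (off k i) //.
  by rewrite subr0 sub0r => /eqP; rewrite subr_eq0 => /eqP.
exists (B ord0 ord0); apply/matrixP => i k; rewrite mxE.
have [<-|/off ->] := eqVneq i k; last by rewrite mulr0n.
by rewrite mulr1n (diag i ord0).
Qed.

Lemma exists_PGL_automorphisms : exists f : {morphism [set: {'GL_n.+2[F]}] >-> {perm 'rV[F]_N}},
  [/\ forall g A, f g (cw A) = cw (invmx (GLval g) *m A *m GLval g),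
      (f @* [set: {'GL_n.+2[F]}] \subset code_aut C)%g &
      ('ker f = 'Z('GL_n.+2[F]))%g].
Proof.
have GU (g : {'GL_n.+2[F]}) : GLval g \in unitmx := GL_unitmx g.
(* The inverse stands on the left to give a right action, matching the product of permutations. *)
pose rho (g : {'GL_n.+2[F]}) (A : 'M[F]_n.+2) : 'M[F]_n.+2 :=
  invmx (GLval g) *m A *m GLval g.
have [||||f [fE f_aut]] := @lift_code_aut _ _ C _ cw CP _ rho.
- by move=> g a A B; rewrite /rho mulmxDr mulmxDl -scalemxAr -scalemxAl.
- by move=> A; rewrite /rho GL_1E invmx1 mul1mx mulmx1.
- move=> g h A; rewrite /rho -GL_VxE invMg !GL_MxE !GL_VxE.
  by rewrite !mulmxA.
- move=> g A; apply/eqP; rewrite (hamming_weight_eq X_neq0 Y_neq0 XY XY_inj XY_surj).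
  by rewrite card_flags_conj.
exists f; split=> //; apply/finset.setP => g; apply/idP/idP.
  rewrite inE => /andP[_]; rewrite inE => /set1P fg.
  have /comm_delta_scalar gs i j : i != j ->
      delta_mx i j *m GLval g = GLval g *m delta_mx i j.
    (* Equality of codewords determines matrices only up to scalar matrices, whence
       [conj_delta_comm]. *)
    move=> ij; have := fE g (delta_mx i j); rewrite fg perm1 => /esym/eqP.
    rewrite -subr_eq0 -linearB => /eqP/codeword_eq0[s].
    exact: conj_delta_comm.
  apply/centerP; split=> [|h _]; first by rewrite inE.
  have gh : GLval (g * h)%g = GLval (h * g)%g by rewrite !GL_MxE gs scalar_mxC.
  by apply: val_inj; exact: gh.
move=> /centerP[_ gC].
have /comm_delta_scalar gs i j : i != j ->
    delta_mx i j *m GLval g = GLval g *m delta_mx i j.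
  (* [E_ij] is not invertible, so centrality is applied to [1 + E_ij] and the identity is
     cancelled. *)
  move=> /(delta_mx_unit F) hU; pose h : {'GL_n.+2[F]} := FinRing.Unit hU.
  have hT : h \in ('GL_n.+2[F])%g by rewrite inE.
  have : GLval (g * h)%g = GLval (h * g)%g by rewrite (gC h hT).
  rewrite !GL_MxE [GLval h]/(1%:M + delta_mx i j).
  by rewrite mulmxDl mulmxDr mul1mx mulmx1 => /addrI ->.
rewrite !inE /=; apply/eqP; apply: (@code_aut_ext _ _ C) => [||_ /CP[A ->]].
- by rewrite (fintype.subsetP f_aut) // mem_morphim ?inE.
- exact: group1.
- rewrite fE perm1 /rho [in X in _ *m X]gs scalar_mxC -gs.
  by rewrite mulKVmx.
Qed.

Lemma exists_scalar_automorphisms : exists f : {morphism [set: {unit F}] >-> {perm 'rV[F]_N}},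
  [/\ forall a A, f a (cw A) = cw (val a *: A),
      (f @* [set: {unit F}] \subset code_aut C)%g & ('injm f)%g].
Proof.
pose rho (a : {unit F}) (A : 'M[F]_n.+2) : 'M[F]_n.+2 := val a *: A.
have [||||f [fE f_aut]] := @lift_code_aut _ _ C _ cw CP _ rho.
- by move=> a b A B; rewrite /rho scalerDr !scalerA mulrC.
- by move=> A; rewrite /rho scale1r.
- by move=> a b A; rewrite /rho scalerA mulrC.
- move=> a A; apply: eq_card => j; rewrite !inE /rho linearZ mxE mulf_eq0.
  by have := valP a; rewrite unitfE => /negPf ->.
exists f; split=> //; apply/injmP => a b _ _ fab; apply: val_inj => /=.
(* No nonzero multiple of this off-diagonal matrix is scalar, so its codeword separates the
   scalars. *)
pose E : 'M[F]_n.+2 := delta_mx ord0 ord_max.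
have := fE a E; rewrite fab fE => /eqP; rewrite eq_sym -subr_eq0 -linearB.
rewrite -scalerBl => /eqP/codeword_eq0[s /matrixP/(_ ord0 ord_max)].
by rewrite !mxE !eqxx mulr1 mulr0n => /eqP; rewrite subr_eq0 => /eqP.
Qed.

(** [H] and [K] are the images of the two morphisms; they centralise each other because scaling
    commutes with conjugation. The first isomorphism theorem identifies [H] with PGL. *)
Lemma automorphism_groups : exists G H K : {group {perm 'rV[F]_N}},
  [/\ G \subset code_aut C, (H \* K)%g = G, H \isog PGL n.+2 F & K \isog [set: {unit F}]].
Proof.
have [f [fE f_aut f_ker]] := exists_PGL_automorphisms.
have [k [kE k_aut k_inj]] := exists_scalar_automorphisms.
pose H := (f @* [set: {'GL_n.+2[F]}])%G; pose K := (k @* [set: {unit F}])%G.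
have HK : (K \subset 'C(H))%g.
  apply/centsP => _ /morphimP[a _ _ ->] _ /morphimP[g _ _ ->]; rewrite /commute.
  have fg : f g \in code_aut C by rewrite (fintype.subsetP f_aut) ?mem_morphim ?inE.
  have ka : k a \in code_aut C by rewrite (fintype.subsetP k_aut) ?mem_morphim ?inE.
  apply: (@code_aut_ext _ _ C); rewrite ?groupM // => _ /CP[A ->].
  by rewrite !permM fE !kE fE -scalemxAr -scalemxAl.
exists (H <*> K)%G, H, K; split.
- by rewrite join_subG f_aut k_aut.
- by rewrite cprodEY.
- by rewrite isog_sym /PGL -f_ker first_isog.
- by rewrite isog_sym sub_isog.
Qed.

End Automorphisms.

Theorem theorem1p2 (q n : nat) (F : finFieldType) (V : vectType F)
    (hq : #|F| = q) (hn : (1 <= n)%N) (hV : \dim {:V} = n.+1)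
    (N : nat) (v : 'I_N -> tensor V (dual V))
    (hv : representatives (@Lambda1 F V) v) :
  (* [None] stands for the additional element 0 *)
  (exists f : nat -> option (seq nat),
     set_bij (code_weights (code v))
             (Some @` profiles q n `|` [set None])%classic f) /\
  (exists G H K : {group {perm 'rV[F]_N}},
     [/\ G \subset code_aut (code v),
         (H \* K)%g = G,
         H \isog PGL n.+1 F
       & K \isog [set: {unit F}]]).
Proof.
have [X [Y [[X0 Y0 XY] XY_inj XY_surj CP]]] := Lambda1_coordinates hV hv.
rewrite -hq; split; first exact: (code_weights_profiles _ _ XY _ _ _ hn CP).
(* As [n = 0] is excluded by [hn], the dimension takes the form [n.+2]. *)
case: n hn hV X Y X0 Y0 XY XY_inj XY_surj CP => // n _ _ X Y X0 Y0 XY XY_inj XY_surj CP.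
exact: (automorphism_groups _ _ XY _ _ CP).
Qed.
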